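(* Let $\mathfrak{A}$ be a unital $\mathrm{C}^*$-algebra and let $\mathfrak{J}\subset\mathfrak{A}$ be a closed two-sided ideal with contractive approximate identity $(e_\lambda)_{\lambda\in\Lambda}$. Let $\chi$ be a state on $\mathfrak{A}$ such that $$\lim_\lambda\chi(ae_\lambda)=\chi(a)$$ for every $a\in\mathfrak{A}$. Then, $\chi$ has the unique extension property with respect to $\mathfrak{J}+\mathbb{C}I$.
   Context: A contractive approximate identity for $\mathfrak{J}$ is a net $(e_\lambda)_{\lambda\in\Lambda}$ of positive elements of $\mathfrak{J}$ with $\|e_\lambda\|\le1$ for every $\lambda$ and $\lim_\lambda\|be_\lambda-b\|=\lim_\lambda\|e_\lambda b-b\|=0$ for every $b\in\mathfrak{J}$. A state $\chi$ on $\mathfrak{A}$ has the unique extension property with respect to a unital self-adjoint subspace $\mathfrak{S}\subset\mathfrak{A}$ if the only (completely) positive linear functional on $\mathfrak{A}$ extending $\chi|_{\mathfrak{S}}$ is $\chi$ itself. *)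

(* Defs.v *)
From HB Require Import structures.
From mathcomp Require Import all_boot all_order all_algebra.
From mathcomp Require Import complex.
From mathcomp Require Import all_classical all_reals all_analysis.

Set Implicit Arguments.
Unset Strict Implicit.
Unset Printing Implicit Defensive.

Import Order.TTheory GRing.Theory Num.Theory.
Import numFieldNormedType.Exports.

Local Open Scope complex_scope.
Local Open Scope classical_set_scope.
Local Open Scope ring_scope.

(* MathComp-Analysis has no structure joining algType and normedModType, and
   Hierarchy-Builder does not allow such a join to be added afterwards.  So
   the norm of the algebra is the field [cnorm], and the alias [normed A]
   carries the normed module structure (hence the topology) it induces.
   Since [algType] rings are nontrivial, the zero algebra is excluded; it has
   no states. *)
HB.mixin Record isCStarNormed (R : realType) A & GRing.Algebra R[i] A := {
  star : A -> A;
  starK : forall a : A, star (star a) = a;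
  starD : forall a b : A, star (a + b) = star a + star b;
  starZ : forall (c : R[i]) (a : A), star (c *: a) = c^* *: star a;
  starM : forall a b : A, star (a * b) = star b * star a;
  cnorm : A -> R;
  cnormD : forall a b : A, cnorm (a + b) <= cnorm a + cnorm b;
  cnormZ : forall (c : R[i]) (a : A), (cnorm (c *: a))%:C = `|c| * (cnorm a)%:C;
  cnorm0_eq0 : forall a : A, cnorm a = 0 -> a = 0;
  cnormM : forall a b : A, cnorm (a * b) <= cnorm a * cnorm b;
  cnorm_star : forall a : A, cnorm (star a * a) = cnorm a ^+ 2
}.

#[short(type="preCStarAlgType")]
HB.structure Definition PreCStarAlg (R : realType) :=
  {A of GRing.Algebra R[i] A & isCStarNormed R A}.

Definition normed (R : realType) (A : preCStarAlgType R) : Type := A.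

Section Normed.
Variables (R : realType) (A : preCStarAlgType R).

HB.instance Definition _ := GRing.Lmodule.copy (normed A) A.

Let nrm (a : normed A) : R[i] := (cnorm (a : A))%:C.

Let nrmD (a b : normed A) : nrm (a + b) <= nrm a + nrm b.
Proof. by rewrite /nrm -rmorphD lecR; exact: cnormD. Qed.

Let nrmZ (c : R[i]) (a : normed A) : nrm (c *: a) = `|c| * nrm a.
Proof. exact: cnormZ. Qed.

Let nrm0_eq0 (a : normed A) : nrm a = 0 -> a = 0.
Proof. by move=> /complexI/cnorm0_eq0. Qed.

HB.instance Definition _ :=
  Lmodule_isNormed.Build R[i] (normed A) nrmD nrmZ nrm0_eq0.

End Normed.

HB.mixin Record isCStarComplete (R : realType) A & PreCStarAlg R A := {
  cstar_complete : forall F : set_system (normed A),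
    ProperFilter F -> cauchy F -> cvg F
}.

#[short(type="unitalCStarAlgType")]
HB.structure Definition UnitalCStarAlg (R : realType) :=
  {A of PreCStarAlg R A & isCStarComplete R A}.

Section Definitions.
Variables (R : realType) (A : unitalCStarAlgType R).

Definition is_subspace (S : set A) : Prop :=
  S 0 /\ forall (c : R[i]) (a b : A), S a -> S b -> S (c *: a + b).

Definition closed_ideal (J : set A) : Prop :=
  [/\ is_subspace J,
      forall a b : A, J b -> J (a * b),
      forall a b : A, J b -> J (b * a)
    & closed (J : set (normed A))].

Definition unital_selfadjoint_subspace (S : set A) : Prop :=
  [/\ is_subspace S, S 1 & forall a : A, S a -> S (star a)].

Definition positive (a : A) : Prop := exists b : A, a = star b * b.

(* On R[i], [0 <= z] means that z is real and nonnegative. *)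
Definition positive_functional (phi : {scalar A}) : Prop :=
  forall a : A, positive a -> 0 <= phi a.

Definition functional_norm (phi : {scalar A}) : \bar R :=
  ereal_sup [set (complex.Re `|phi a|)%:E | a in [set a : A | cnorm a <= 1]].

Definition state (chi : {scalar A}) : Prop :=
  positive_functional chi /\ functional_norm chi = 1%:E.

Definition directed (I : Type) (le : I -> I -> Prop) : Prop :=
  [/\ exists i : I, True,
      forall i, le i i,
      forall i j k, le i j -> le j k -> le i k
    & forall i j, exists k, le i k /\ le j k].

Definition tails (I : Type) (le : I -> I -> Prop) : set_system I :=
  filter_from setT (fun i => [set j | le i j]).

Definition contractive_approximate_identity (J : set A)
    (I : Type) (le : I -> I -> Prop) (e : I -> A) : Prop :=
  [/\ directed le,
      forall i, J (e i) /\ positive (e i),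
      forall i, cnorm (e i) <= 1,
      forall b : A, J b -> cnorm (b * e i - b) @[i --> tails le] --> (0 : R)
    & forall b : A, J b -> cnorm (e i * b - b) @[i --> tails le] --> (0 : R)].

Definition plus_scalars (J : set A) : set A :=
  [set a | exists b : A, exists c : R[i], J b /\ a = b + c *: 1].

(* Extensions are only required to be positive, which for functionals is the
   same as completely positive. *)
Definition unique_extension_property (S : set A) (chi : {scalar A}) : Prop :=
  unital_selfadjoint_subspace S /\
  forall psi : {scalar A}, positive_functional psi ->
    (forall a : A, S a -> psi a = chi a) -> forall a : A, psi a = chi a.

End Definitions.

(* Main.v *)
Require Import Defs.
From HB Require Import structures.
From mathcomp Require Import all_boot all_order all_algebra.
From mathcomp Require Import complex.
From mathcomp Require Import all_classical all_reals all_analysis.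
From mathcomp Require Import ring lra.
Import Order.TTheory GRing.Theory Num.Theory.
Import numFieldNormedType.Exports.
Local Open Scope classical_set_scope.
Local Open Scope ring_scope.

(** A positive functional [psi] that agrees with [chi] on [J + C 1] agrees with
    it everywhere because [psi] cannot tell [a] from [a * e i] in the limit.
    The Cauchy-Schwarz inequality for [psi] gives

      |psi (a (1 - e i))|^2 <= psi (a a^* ) * psi ((1 - e i)^2).

    The elements [a * e i], [1], [e i] and [(e i)^2] all lie in [J + C 1], where
    [psi] is [chi].  So the left-hand side is |psi a - chi (a * e i)|^2, and the
    last factor is

      chi 1 - 2 chi (e i) + chi ((e i)^2) <= 2 (1 - chi (e i)),

    using [chi 1 = 1] and [chi ((e i)^2) <= 1], the latter because
    [||chi|| = 1] and [||e i|| <= 1] ([extension_defect_le]).  The hypothesis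
    on [chi], taken at [a] and at [1], makes [chi (a * e i)] tend to [chi a]
    and [chi (e i)] tend to 1, so [psi a = chi a] ([extension_unique]).

    Bounding [chi ((e i)^2)] by the norm of [chi] instead of by [chi (e i)], and
    obtaining [chi 1 = 1] from Cauchy-Schwarz ([state_1]), keeps the argument
    free of functional calculus.  That [J + C 1] is self-adjoint also comes from
    the approximate identity: [e i * b^*] lies in [J] and tends to [b^*], and
    [J] is closed ([ideal_star]). *)

(** * The involution and the norm *)

Section CStarAlgebra.
Context {R : realType} {A : unitalCStarAlgType R}.
Implicit Types (a b x y : A) (phi : {scalar A}).

Lemma star0 : star (0 : A) = 0.
Proof. by apply: (addrI (star 0)); rewrite -starD !addr0. Qed.

Lemma starN a : star (- a) = - star a.
Proof. by apply: (addrI (star a)); rewrite -starD !subrr star0. Qed.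

Lemma star1 : star (1 : A) = 1.
Proof. by rewrite -[LHS]mulr1 -[X in _ * X]starK -starM mulr1 starK. Qed.

Lemma cnorm_ge0 a : 0 <= cnorm a.
Proof.
have : 0 <= `|a : normed A| by [].
by rewrite -lecR.
Qed.

Lemma le_cnorm_star a : cnorm a <= cnorm (star a).
Proof.
have [a0|a0] := eqVneq (cnorm a) 0; first by rewrite a0 cnorm_ge0.
have agt0 : 0 < cnorm a by rewrite lt_neqAle eq_sym a0 cnorm_ge0.
by rewrite -(ler_pM2r agt0) -expr2 -cnorm_star cnormM.
Qed.

Lemma isometric_star a : cnorm (star a) = cnorm a.
Proof.
apply/eqP; rewrite eq_le le_cnorm_star andbT.
by rewrite -[in leRHS](starK a) le_cnorm_star.
Qed.

Lemma cnorm1_le1 : cnorm (1 : A) <= 1.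
Proof.
have := cnorm_star (1 : A); rewrite star1 mulr1 => h.
have := cnorm_ge0 (1 : A); nra.
Qed.

Lemma positive_star a : positive a -> star a = a.
Proof. by move=> [b ->]; rewrite starM starK. Qed.

Lemma positive_mul_star a : positive (star a * a).
Proof. by exists a. Qed.

(** * Positive functionals and the Cauchy-Schwarz inequality *)

Lemma functional_gram phi x y (c : R[i]) :
  phi (star (x + c *: y) * (x + c *: y)) =
    phi (star x * x) + c * phi (star x * y) + c^* * phi (star y * x)
    + c^* * c * phi (star y * y).
Proof.
rewrite starD starZ mulrDl !mulrDr -!scalerAl -!scalerAr.
rewrite !raddfD /= !linearZ /= !addrA; congr (_ + _).
exact: mulrCA.
Qed.

Section PositiveFunctional.
Variable phi : {scalar A}.
Hypothesis phi_pos : positive_functional phi.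

Lemma ge0_functional_mul_star x : 0 <= phi (star x * x).
Proof. exact/phi_pos/positive_mul_star. Qed.

(** By [functional_gram], [c r + c^* r'] is a difference of real numbers for
    every scalar [c]; [c = 1] and [c = 'i] together force [r' = r^*]. *)
Lemma functional_hermitian x y : phi (star y * x) = (phi (star x * y))^*.
Proof.
set r := phi (star x * y); set r' := phi (star y * x).
have cross_real c : (c * r + c^* * r')^* = c * r + c^* * r'.
  apply/CrealP.
  have -> : c * r + c^* * r' = phi (star (x + c *: y) * (x + c *: y))
      - phi (star x * x) - c^* * c * phi (star y * y).
    by rewrite functional_gram; ring.
  rewrite !rpredB ?ger0_real ?ge0_functional_mul_star //.
  by rewrite mulr_ge0 ?ge0_functional_mul_star // mulrC mul_conjC_ge0.
have := cross_real 'i; have := cross_real 1.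
rewrite !rmorphD !rmorphM /= !rmorph1 !conjCi rmorphN /= conjCi => h1 hi.
have diff : r^* - r'^* = - (r - r').
  apply: (mulfI (neq0Ci _)); rewrite mulrN.
  have -> : 'i * (r - r') = 'i * r + - 'i * r' by ring.
  by rewrite -hi; ring.
apply: (@mulfI _ 2); first by rewrite pnatr_eq0.
have -> : 2 * r' = (1 * r + 1 * r') + - (r - r') by ring.
by rewrite -h1 -diff; ring.
Qed.

(** Positivity on [x - t r^* y], with [r = phi (x^* y)] and [t] real, gives a
    real quadratic in [t] that is nonnegative everywhere. *)
Lemma functional_CauchySchwarz x y :
  `|phi (star x * y)| ^+ 2 <= phi (star x * x) * phi (star y * y).
Proof.
set r := phi (star x * y); set p := phi (star x * x).
set q := phi (star y * y).
have p_ge0 : 0 <= p := ge0_functional_mul_star x.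
have q_ge0 : 0 <= q := ge0_functional_mul_star y.
have gram_ge0 (t : R[i]) : t \is Num.real ->
    0 <= p - 2 * t * `|r| ^+ 2 + t ^+ 2 * `|r| ^+ 2 * q.
  move=> /CrealP t_real.
  have := ge0_functional_mul_star (x + (- t * r^*) *: y).
  rewrite functional_gram (functional_hermitian x y) -/r -/p -/q.
  rewrite rmorphM rmorphN /= conjCK t_real normCK.
  by congr (0 <= _); ring.
have [q0|q_neq0] := eqVneq q 0.
  rewrite q0 mulr0.
  have [->|r_neq0] := eqVneq r 0; first by rewrite normr0 expr0n.
  have n_neq0 : `|r| ^+ 2 != 0 by rewrite sqrf_eq0 normr_eq0.
  (* The quadratic is affine in t; this t makes it take the value - (p + 2). *)
  have t_real : (p + 1) / `|r| ^+ 2 \is Num.real.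
    by rewrite ger0_real // divr_ge0 ?exprn_ge0 ?addr_ge0.
  have := gram_ge0 _ t_real; rewrite q0 mulr0 addr0.
  have -> : p - 2 * ((p + 1) / `|r| ^+ 2) * `|r| ^+ 2 = - (p + 2).
    by rewrite -[2 * _ * _]mulrA divfK //; ring.
  by rewrite oppr_ge0 => /(lt_le_trans (ltr_wpDl p_ge0 (ltr0Sn _ 1)));
    rewrite ltxx.
have q_gt0 : 0 < q by rewrite lt_neqAle eq_sym q_neq0.
(* 1 / q is the minimizer of the quadratic. *)
have q_inv_real : q^-1 \is Num.real by rewrite ger0_real ?invr_ge0.
have := gram_ge0 _ q_inv_real.
have -> : p - 2 * q^-1 * `|r| ^+ 2 + q^-1 ^+ 2 * `|r| ^+ 2 * q
    = p - `|r| ^+ 2 / q by field.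
by rewrite subr_ge0 ler_pdivrMr.
Qed.

End PositiveFunctional.

(** * States *)

Lemma functional_norm_le1 phi a :
  functional_norm phi = 1%:E -> cnorm a <= 1 -> `|phi a| <= 1.
Proof.
move=> phi1 a1.
have : ((complex.Re `|phi a|)%:E <= 1%:E)%E.
  by rewrite -phi1; apply: ereal_sup_ubound; exists a.
rewrite lee_fin => h.
have -> : `|phi a| = ((complex.Re `|phi a|)%:C)%C by rewrite RRe_real ?normr_real.
by rewrite -[leRHS]/((1%:C)%C) lecR.
Qed.

(** Cauchy-Schwarz against [1] gives [|phi a|^2 <= phi 1 * phi (a^* a) <= phi 1]
    on the unit ball; taking suprema, [1 = ||phi|| <= sqrt (phi 1)]. *)
Lemma state_1 phi : state phi -> phi 1 = 1.
Proof.
move=> [phi_pos phi1].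
have := ge0_functional_mul_star _ phi_pos 1; rewrite star1 mulr1 => p_ge0.
have norm_le a : cnorm a <= 1 -> `|phi a| ^+ 2 <= phi 1.
  move=> a1.
  have := functional_CauchySchwarz _ phi_pos 1 a; rewrite star1 !mul1r.
  move=> /le_trans; apply.
  rewrite -[leRHS]mulr1 ler_wpM2l //.
  apply: le_trans (real_ler_norm (ger0_real _)) _.
    exact: ge0_functional_mul_star.
  apply: functional_norm_le1 => //.
  by rewrite cnorm_star expr_le1 // cnorm_ge0.
have le1 : phi 1 <= 1.
  apply: le_trans (real_ler_norm (ger0_real p_ge0)) _.
  exact: functional_norm_le1 cnorm1_le1.
apply/eqP; rewrite eq_le le1 /=.
have p_Re : phi 1 = ((complex.Re (phi 1))%:C)%C by rewrite RRe_real ?ger0_real.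
have : (1%:E <= (Num.sqrt (complex.Re (phi 1)))%:E)%E.
  rewrite -phi1; apply: ge_ereal_sup => _ [a /= a1 <-].
  have n_Re : `|phi a| = ((complex.Re `|phi a|)%:C)%C by rewrite RRe_real ?normr_real.
  have := norm_le a a1; rewrite p_Re n_Re -rmorphXn lecR /= => h.
  rewrite lee_fin -[leLHS]ger0_norm; last by rewrite -lecR -n_Re; exact: normr_ge0.
  by rewrite -sqrtr_sqr ler_wsqrtr.
by rewrite lee_fin -[leLHS]sqrtr1 ler_psqrt ?qualifE /= ?ler01 -?lecR -?p_Re.
Qed.

(** * Ideals with an approximate identity *)

Lemma tails_proper (I : Type) (le : I -> I -> Prop) :
  directed le -> ProperFilter (tails le).
Proof.
move=> [[i0 _] le_refl le_trans le_ub].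
apply: filter_from_proper; last by move=> i _; exists i.
apply: filter_from_filter; first by exists i0.
move=> i j _ _; have [k [ik jk]] := le_ub i j.
by exists k => // l kl; split; apply: le_trans kl.
Qed.

Section ApproximateIdentity.
Context (J : set A) (I : Type) (le : I -> I -> Prop) (e : I -> A).
Hypothesis J_ideal : closed_ideal J.
Hypothesis e_approx : contractive_approximate_identity J le e.

(** Since [e i] is self-adjoint, [||e i * b^* - b^*|| = ||b * e i - b||] tends to
    0, and [e i * b^*] lies in [J] because [e i] does. *)
Lemma ideal_star b : J b -> J (star b).
Proof.
move=> Jb.
have [_ _ J_mulr J_closed] := J_ideal.
have [le_dir e_in _ be_b _] := e_approx.
have tails_filter := tails_proper _ _ le_dir.
apply: (@closed_cvg _ (normed A) (tails le) _
          (fun i => e i * star b : normed A) J J_closed).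
  by apply: nearW => i; apply: J_mulr; case: (e_in i).
apply/cvgrPdist_lt => eps eps_gt0.
have eps_Re : eps = ((complex.Re eps)%:C)%C by rewrite RRe_real ?gtr0_real.
have /cvgrPdist_lt/(_ (complex.Re eps)) := be_b b Jb.
rewrite -ltcR -eps_Re => /(_ eps_gt0); apply: filterS => i.
rewrite sub0r normrN ger0_norm ?cnorm_ge0 // => h.
rewrite distrC [eps]eps_Re.
rewrite -[ltLHS]/((cnorm (e i * star b - star b))%:C)%C ltcR.
have [_ /positive_star ei_star] := e_in i.
by rewrite -{1}ei_star -starM -starN -starD isometric_star.
Qed.

Lemma plus_scalars_subspace : unital_selfadjoint_subspace (plus_scalars J).
Proof.
have [[J0 J_lin] _ _ _] := J_ideal.
split.
- split; first by exists 0, 0; split; rewrite // scale0r addr0.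
  move=> c _ _ [a [s [Ja ->]]] [b [t [Jb ->]]].
  exists (c *: a + b), (c * s + t); split; first exact: J_lin.
  by rewrite scalerDr scalerDl scalerA addrACA.
- by exists 0, 1; split; rewrite // scale1r add0r.
- move=> _ [b [c [Jb ->]]]; exists (star b), (c^*); split.
    exact: ideal_star.
  by rewrite starD starZ star1.
Qed.

End ApproximateIdentity.

(** * Uniqueness of the positive extension *)

Section UniqueExtension.
Context (J : set A) (chi psi : {scalar A}).
Hypothesis J_ideal : closed_ideal J.
Hypothesis chi_state : state chi.
Hypothesis psi_pos : positive_functional psi.
Hypothesis psi_ext : forall b, plus_scalars J b -> psi b = chi b.

(** Cauchy-Schwarz for [psi] at [a^*] and [1 - u].  The modulus on the right is
    the real number [1 - chi u]; it is written so that a bound on the distance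
    from [chi u] to [1] applies directly. *)
Lemma extension_defect_le a u :
  J u -> star u = u -> cnorm u <= 1 ->
  `|psi a - chi (a * u)| ^+ 2 <= psi (a * star a) * (2 * `|1 - chi u|).
Proof.
move=> Ju u_star u1.
have [_ J_mull _ _] := J_ideal; have [_ chi1] := chi_state.
have psiJ b : J b -> psi b = chi b.
  by move=> Jb; apply: psi_ext; exists b, 0; split; rewrite // scale0r addr0.
have psi1 : psi 1 = 1.
  rewrite -(state_1 _ chi_state) psi_ext //.
  have [[J0 _] _ _ _] := J_ideal.
  by exists 0, 1; split; rewrite // scale1r add0r.
have -> : psi a - chi (a * u) = psi (star (star a) * (1 - u)).
  by rewrite -psiJ; [rewrite starK mulrBr mulr1 raddfB|exact: J_mull].
apply: le_trans (functional_CauchySchwarz _ psi_pos _ _) _.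
rewrite starK ler_wpM2l //.
  by rewrite -{1}(starK a) ge0_functional_mul_star.
have defectE : psi (star (1 - u) * (1 - u)) =
    2 * (1 - chi u) - (1 - chi (star u * u)).
  rewrite starD starN star1 u_star mulrBr mulr1 mulrBl mul1r !raddfB /=.
  by rewrite psi1 !psiJ //; [ring|exact: J_mull].
have sq_le1 : 0 <= 1 - chi (star u * u).
  rewrite subr_ge0; apply: le_trans (real_ler_norm (ger0_real _)) _.
    by case: chi_state => chi_pos _; apply: ge0_functional_mul_star.
  by apply: functional_norm_le1 => //; rewrite cnorm_star expr_le1 ?cnorm_ge0.
have defect_ge0 : 0 <= 2 * (1 - chi u).
  have -> : 2 * (1 - chi u) = psi (star (1 - u) * (1 - u))
      + (1 - chi (star u * u)) by rewrite defectE subrK.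
  by rewrite addr_ge0 // ge0_functional_mul_star.
rewrite defectE lerBlDr; apply: ler_wpDr => //.
by rewrite ler_pM2l // real_ler_norm // ger0_real // -(pmulr_rge0 _ (ltr0Sn _ 1)).
Qed.

(** If [z = |psi a - chi a|] were positive, choosing [i] with [chi (a * e i)]
    within [z / 4] of [chi a], and [chi (e i)] close enough to 1 for
    [extension_defect_le] to put [psi a] within [z / 4] of [chi (a * e i)], would
    give [z <= z / 2]. *)
Lemma extension_unique (I : Type) (F : set_system I) (e : I -> A) a :
  ProperFilter F ->
  (forall i, [/\ J (e i), star (e i) = e i & cnorm (e i) <= 1]) ->
  (forall b, chi (b * e i) @[i --> F] --> (chi b : R[i]^o)) ->
  psi a = chi a.
Proof.
move=> F_proper e_in chi_lim; apply/eqP; rewrite -subr_eq0 -normr_le0.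
set z := `|psi a - chi a|; set p := psi (a * star a).
have p_ge0 : 0 <= p.
  by rewrite /p -{1}(starK a) ge0_functional_mul_star.
have [z0|z_neq0] := eqVneq z 0; first by rewrite z0.
have z_gt0 : 0 < z by rewrite lt_neqAle eq_sym z_neq0 normr_ge0.
have d_gt0 : 0 < z / 4 by rewrite divr_gt0.
(* p may vanish, so the tolerance divides by p + 1. *)
have p1_gt0 : 0 < 2 * (p + 1) by rewrite mulr_gt0 // ltr_wpDl.
have eps_gt0 : 0 < (z / 4) ^+ 2 / (2 * (p + 1)).
  by rewrite divr_gt0 ?exprn_gt0.
have near_chi b := (@cvgrPdist_lt _ R[i]^o _ F _ _ _).1 (chi_lim b).
have [i [/= ai]] := filter_ex (filterI (near_chi _ a _ d_gt0) (near_chi _ 1 _ eps_gt0)).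
rewrite mul1r (state_1 _ chi_state) => ei.
have [Je e_star e1] := e_in i.
have dist_le : `|psi a - chi (a * e i)| <= z / 4.
  rewrite -(ler_pXn2r (_ : 0 < 2)%N) ?nnegrE ?(ltW d_gt0) //.
  apply: le_trans (extension_defect_le a _ Je e_star e1) _.
  rewrite -/p; apply: (@le_trans _ _ ((2 * (p + 1)) * `|1 - chi (e i)|)).
    rewrite mulrA [p * 2]mulrC ler_wpM2r // ler_pM2l //.
    by rewrite lerDl.
  by rewrite mulrC -ler_pdivlMr // ltW.
have : z <= z / 4 + z / 4.
  rewrite {1}/z -(subrK (chi (a * e i)) (psi a)) -addrA.
  apply: le_trans (ler_normD _ _) _; apply: lerD => //.
  by rewrite distrC ltW.
have -> : z / 4 + z / 4 = z / 2 by field.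
by rewrite ler_pdivlMr // mulr_natr mulr2n gerDl.
Qed.

End UniqueExtension.

End CStarAlgebra.

Theorem theorem4p3 (R : realType) (A : unitalCStarAlgType R) (J : set A)
    (I : Type) (le : I -> I -> Prop) (e : I -> A) (chi : {scalar A}) :
  closed_ideal J ->
  contractive_approximate_identity J le e ->
  state chi ->
  (forall a : A, chi (a * e i) @[i --> tails le] --> (chi a : R[i]^o)) ->
  unique_extension_property (plus_scalars J) chi.
Proof.
move=> J_ideal e_approx chi_state chi_lim; split.
  exact: plus_scalars_subspace e_approx.
move=> psi psi_pos psi_ext a.
have [le_dir e_in e1 _ _] := e_approx.
apply: (@extension_unique _ _ J chi psi J_ideal chi_state psi_pos psi_ext
          _ (tails le) e) => //.
  exact: tails_proper.
by move=> i; have [Je /positive_star e_star] := e_in i.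
Qed.
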